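(* Let $E,A\in\mathbb{R}^{n\times n}$ with $\operatorname{rank}(E)=r$. Then $(E,A)$ is regular, of index at most one, and asymptotically stable if and only if there exist invertible $T,W\in\mathbb{R}^{n\times n}$ and $S,U,B\in\mathbb{R}^{r\times r}$ with $S$ invertible, $U^TU=I_r$, $B$ symmetric positive semidefinite and $\|B\|<1$, such that $$E=W\begin{bmatrix} I_r&0\\0&0\end{bmatrix}T,\qquad A=W\begin{bmatrix} S^{-1}UBS&0\\0&I_{n-r}\end{bmatrix}T.$$
   Context: A pair $(E,A)$ of real $n\times n$ matrices is regular if $\det(\lambda E-A)$ is not identically zero in $\lambda$; its finite eigenvalues are the roots of $\det(zE-A)$. The index of a regular pair is defined via the Weierstrass canonical form $E=W\operatorname{diag}(I_q,N)T$, $A=W\operatorname{diag}(J,I_{n-q})T$ ($N$ nilpotent) as the nilpotency degree of $N$ if $q<n$, and $0$ if $E$ is nonsingular. The pair is asymptotically stable if all its finite eigenvalues lie in the open unit disk $\{|z|<1\}$. $\|\cdot\|$ is the spectral norm. *)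

(* Defs.v *)
(* The real field R is modelled as the real subfield
   (Num.real) of an arbitrary numeric closed field C (e.g. C = complex numbers);
   "real n x n matrices" are matrices over C all of whose entries are real. *)
From HB Require Import structures.
From mathcomp Require Import all_boot all_order all_algebra.
Set Implicit Arguments. Unset Strict Implicit. Unset Printing Implicit Defensive.
Import Order.TTheory GRing.Theory Num.Theory.
Local Open Scope ring_scope.

Section Defs.
Context {C : numClosedFieldType}.

Definition is_real_mx (m n : nat) (M : 'M[C]_(m, n)) : Prop :=
  M \is a mxOver (Num.real : {pred C}).

Definition pencil (n : nat) (E A : 'M[C]_n) : 'M[{poly C}]_n :=
  'X *: map_mx polyC E - map_mx polyC A.

Definition regular_pair (n : nat) (E A : 'M[C]_n) : Prop :=
  \det (pencil E A) != 0.

Definition finite_eigenvalue (n : nat) (E A : 'M[C]_n) (z : C) : Prop :=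
  \det (z *: E - A) = 0.

Definition asympt_stable (n : nat) (E A : 'M[C]_n) : Prop :=
  forall z : C, finite_eigenvalue E A z -> `|z| < 1.

Definition nilpotency_degree (m : nat) (N : 'M[C]_m) (k : nat) : Prop :=
  N ^+ k = 0 /\ forall j, (j < k)%N -> N ^+ j != 0.

(* (E,A) has a (real) Weierstrass canonical form
     E = W diag(I_q, N) T,  A = W diag(J, I_{n-q}) T   (N nilpotent)
   whose associated index (nilpotency degree of N if q < n, 0 if q = n) is k. *)
Definition has_index (n : nat) (E A : 'M[C]_n) (k : nat) : Prop :=
  exists (q m : nat) (h : (q + m = n)%N) (W T : 'M[C]_n)
         (J : 'M[C]_q) (N : 'M[C]_m),
    [/\ is_real_mx W, is_real_mx T, is_real_mx J & is_real_mx N] /\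
    [/\ W \in unitmx, T \in unitmx & exists j, N ^+ j = 0] /\
    E = W *m castmx (h, h) (block_mx 1%:M 0 0 N) *m T /\
    A = W *m castmx (h, h) (block_mx J 0 0 1%:M) *m T /\
    (if (q < n)%N then nilpotency_degree N k else k = 0%N).

Definition index_le1 (n : nat) (E A : 'M[C]_n) : Prop :=
  exists k, (k <= 1)%N /\ has_index E A k.

Definition vnorm2 (n : nat) (x : 'cV[C]_n) : C := \sum_i `|x i 0| ^+ 2.

Definition is_spec_norm (n : nat) (B : 'M[C]_n) (s : C) : Prop :=
  [/\ s \is Num.real, 0 <= s,
      (forall x : 'cV[C]_n, is_real_mx x -> vnorm2 (B *m x) <= s ^+ 2 * vnorm2 x)
    & (forall c : C, c \is Num.real -> 0 <= c ->
         (forall x : 'cV[C]_n, is_real_mx x -> vnorm2 (B *m x) <= c ^+ 2 * vnorm2 x) ->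
         s <= c)].

Definition sym_psd (n : nat) (B : 'M[C]_n) : Prop :=
  B^T = B /\ forall x : 'cV[C]_n, is_real_mx x -> 0 <= (x^T *m B *m x) 0 0.

End Defs.

(* Main.v *)
(* Index at most one means that the nilpotent block vanishes, so the pair is
   governed by the real r x r block J, whose eigenvalues are those of (E, A).
   If they all lie in the open unit disk, then triangularizing J over C and
   scaling the basis makes J a strict contraction for some complex Euclidean
   norm; restricted to real vectors this norm is x |-> |S x| with S real
   (Cholesky), so S J S^-1 is a strict contraction. Its real singular value
   decomposition yields the polar form U B, and the spectral norm of B is the
   largest singular value. Conversely, if U B y = z y then |z| |y| = |B y|,
   and the bound |B y| <= |B| |y| extends from real to complex y by splitting
   into real and imaginary parts. *)
Require Import Defs.
From HB Require Import structures.
From mathcomp Require Import all_boot all_order all_algebra ring.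
Import Order.TTheory GRing.Theory Num.Theory.
Local Open Scope ring_scope.

Section RealContractions.
Set Implicit Arguments. Unset Strict Implicit. Unset Printing Implicit Defensive.
Context {C : numClosedFieldType}.

(** * Real matrices and the Euclidean norm *)

Lemma is_real_mxP m n (M : 'M[C]_(m, n)) : is_real_mx M <-> map_mx Num.conj M = M.
Proof.
split=> [/mxOverP h|h]; first by apply/matrixP => i j; rewrite mxE; apply/CrealP/h.
by apply/mxOverP => i j; apply/CrealP; rewrite -[in RHS]h mxE.
Qed.

Lemma real_mulmx m n p (M : 'M[C]_(m, n)) (N : 'M[C]_(n, p)) :
  is_real_mx M -> is_real_mx N -> is_real_mx (M *m N).
Proof. by rewrite !is_real_mxP map_mxM => -> ->. Qed.

Lemma real_trmx m n (M : 'M[C]_(m, n)) : is_real_mx M -> is_real_mx M^T.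
Proof. by rewrite !is_real_mxP -map_trmx => ->. Qed.

Lemma real_invmx n (M : 'M[C]_n) : is_real_mx M -> is_real_mx (invmx M).
Proof. by rewrite !is_real_mxP map_invmx => ->. Qed.

Lemma real_addmx m n (M N : 'M[C]_(m, n)) :
  is_real_mx M -> is_real_mx N -> is_real_mx (M + N).
Proof. by rewrite !is_real_mxP map_mxD => -> ->. Qed.

Lemma real_scalemx m n a (M : 'M[C]_(m, n)) :
  a \is Num.real -> is_real_mx M -> is_real_mx (a *: M).
Proof. by rewrite !is_real_mxP map_mxZ /= => /conj_Creal -> ->. Qed.

Lemma real_scalar_mx n (a : C) : a \is Num.real -> is_real_mx (a%:M : 'M_n).
Proof. by rewrite !is_real_mxP map_scalar_mx /= => /conj_Creal ->. Qed.

Lemma real_mx0 m n : is_real_mx (0 : 'M[C]_(m, n)).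
Proof. by rewrite is_real_mxP map_mx0. Qed.

Lemma real_mx1 n : is_real_mx (1%:M : 'M[C]_n).
Proof. exact/real_scalar_mx/real1. Qed.

Lemma real_delta_mx m n i j : is_real_mx (delta_mx i j : 'M[C]_(m, n)).
Proof. by rewrite is_real_mxP map_delta_mx. Qed.

Lemma real_diag_mx n (d : 'rV[C]_n) : is_real_mx d -> is_real_mx (diag_mx d).
Proof. by rewrite !is_real_mxP map_diag_mx => ->. Qed.

Lemma real_block_mx m1 m2 n1 n2 (M1 : 'M[C]_(m1, n1)) (M2 : 'M_(m1, n2))
    (M3 : 'M_(m2, n1)) (M4 : 'M_(m2, n2)) :
  is_real_mx (block_mx M1 M2 M3 M4) <->
  [/\ is_real_mx M1, is_real_mx M2, is_real_mx M3 & is_real_mx M4].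
Proof.
rewrite is_real_mxP map_block_mx; split=> [/eq_block_mx[*]|[]].
  by split; apply/is_real_mxP.
by rewrite !is_real_mxP => -> -> -> ->.
Qed.

Lemma real_col_mx m1 m2 n (M1 : 'M[C]_(m1, n)) (M2 : 'M_(m2, n)) :
  is_real_mx M1 -> is_real_mx M2 -> is_real_mx (col_mx M1 M2).
Proof. by rewrite !is_real_mxP map_col_mx => -> ->. Qed.

Definition mxRe m n (M : 'M[C]_(m, n)) := map_mx (fun z : C => 'Re z) M.
Definition mxIm m n (M : 'M[C]_(m, n)) := map_mx (fun z : C => 'Im z) M.

Lemma real_mxRe m n (M : 'M[C]_(m, n)) : is_real_mx (mxRe M).
Proof. by apply/mxOverP => i j; rewrite mxE Creal_Re. Qed.

Lemma real_mxIm m n (M : 'M[C]_(m, n)) : is_real_mx (mxIm M).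
Proof. by apply/mxOverP => i j; rewrite mxE Creal_Im. Qed.

Lemma mxRect m n (M : 'M[C]_(m, n)) : M = mxRe M + 'i *: mxIm M.
Proof. by apply/matrixP => i j; rewrite !mxE -Crect. Qed.

Lemma mxRe_mulmx m n p (M : 'M[C]_(m, n)) (N : 'M[C]_(n, p)) :
  is_real_mx M -> mxRe (M *m N) = M *m mxRe N.
Proof.
move=> /mxOverP Mr; apply/matrixP => i j; rewrite !mxE raddf_sum.
apply: eq_bigr => k _; rewrite mxE; exact: ReMl (Mr _ _) _.
Qed.

Lemma mxIm_mulmx m n p (M : 'M[C]_(m, n)) (N : 'M[C]_(n, p)) :
  is_real_mx M -> mxIm (M *m N) = M *m mxIm N.
Proof.
move=> /mxOverP Mr; apply/matrixP => i j; rewrite !mxE raddf_sum.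
apply: eq_bigr => k _; rewrite mxE; exact: ImMl (Mr _ _) _.
Qed.

Lemma vnorm2_ge0 n (x : 'cV[C]_n) : 0 <= vnorm2 x.
Proof. by apply: sumr_ge0 => i _; rewrite exprn_ge0. Qed.

Lemma vnorm2_eq0 n (x : 'cV[C]_n) : (vnorm2 x == 0) = (x == 0).
Proof.
apply/idP/eqP => [|->]; last first.
  by rewrite /vnorm2 big1 // => i _; rewrite mxE normr0 expr0n.
rewrite psumr_eq0 => [/allP h|i _]; last by rewrite exprn_ge0.
apply/colP => i; have := h i (mem_index_enum _).
by rewrite mxE expf_eq0 normr_eq0 => /eqP.
Qed.

Lemma vnorm2_gt0 n (x : 'cV[C]_n) : (0 < vnorm2 x) = (x != 0).
Proof. by rewrite lt0r vnorm2_eq0 vnorm2_ge0 andbT. Qed.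

Lemma vnorm2Z n a (x : 'cV[C]_n) : vnorm2 (a *: x) = `|a| ^+ 2 * vnorm2 x.
Proof. by rewrite /vnorm2 mulr_sumr; apply: eq_bigr => i _; rewrite mxE normrM exprMn. Qed.

Lemma vnorm2_col_mx m n (x : 'cV[C]_m) (y : 'cV[C]_n) :
  vnorm2 (col_mx x y) = vnorm2 x + vnorm2 y.
Proof.
rewrite /vnorm2 big_split_ord /=.
by congr (_ + _); apply: eq_bigr => i _; rewrite (col_mxEu, col_mxEd).
Qed.

Lemma vnorm2_dot n (x : 'cV[C]_n) : vnorm2 x = ((map_mx Num.conj x)^T *m x) 0 0.
Proof. by rewrite mxE; apply: eq_bigr => i _; rewrite !mxE normCKC. Qed.

Lemma vnorm2_real n (x : 'cV[C]_n) : is_real_mx x -> vnorm2 x = (x^T *m x) 0 0.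
Proof. by move=> /is_real_mxP xr; rewrite vnorm2_dot xr. Qed.

Lemma vnorm2_rect n (x : 'cV[C]_n) : vnorm2 x = vnorm2 (mxRe x) + vnorm2 (mxIm x).
Proof.
rewrite /vnorm2 -big_split; apply: eq_bigr => i _ /=; rewrite !mxE normC2_Re_Im.
by rewrite !real_normK ?Creal_Re ?Creal_Im.
Qed.

Lemma vnorm2_orth m n (U : 'M[C]_(m, n)) (x : 'cV[C]_n) :
  is_real_mx U -> U^T *m U = 1%:M -> vnorm2 (U *m x) = vnorm2 x.
Proof.
move=> /is_real_mxP Ur UU; rewrite !vnorm2_dot map_mxM Ur trmx_mul.
by rewrite mulmxA -[_ *m U^T *m U]mulmxA UU mulmx1.
Qed.

(* AM-GM: [2 |a| |b| <= d^-1 |a|^2 + d |b|^2]. *)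
Lemma vnorm2D_le n (d : C) (x y : 'cV[C]_n) : 0 < d ->
  vnorm2 (x + y) <= (1 + d^-1) * vnorm2 x + (1 + d) * vnorm2 y.
Proof.
move=> d0; rewrite /vnorm2 !mulr_sumr -big_split; apply: ler_sum => i _ /=.
rewrite mxE; set a := x i 0; set b := y i 0.
apply: (@le_trans _ _ ((`|a| + `|b|) ^+ 2)).
  by rewrite lerXn2r ?nnegrE ?addr_ge0 // ler_normD.
rewrite -subr_ge0; have -> : (1 + d^-1) * `|a| ^+ 2 + (1 + d) * `|b| ^+ 2
  - (`|a| + `|b|) ^+ 2 = d^-1 * (`|a| - d * `|b|) ^+ 2.
  by field; rewrite gt_eqF.
rewrite mulr_ge0 ?invr_ge0 ?(ltW d0) // real_exprn_even_ge0 //.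
by rewrite realB ?realM ?normr_real ?gtr0_real.
Qed.

(** A real matrix acts separately on real and imaginary parts, whose squared norms add up. This
    carries the spectral norm, which is tested on real vectors only, over to complex
    eigenvectors. *)
Lemma real_bound_complex m n (M : 'M[C]_(m, n)) (c : C) : is_real_mx M ->
  (forall x : 'cV_n, is_real_mx x -> vnorm2 (M *m x) <= c * vnorm2 x) ->
  forall x : 'cV_n, vnorm2 (M *m x) <= c * vnorm2 x.
Proof.
move=> Mr h x; rewrite vnorm2_rect (vnorm2_rect x) mulrDr mxRe_mulmx // mxIm_mulmx //.
by apply: lerD; apply: h; [apply: real_mxRe | apply: real_mxIm].
Qed.

Lemma singular_ker n (M : 'M[C]_n) :
  M \notin unitmx -> exists2 x : 'cV_n, x != 0 & M *m x = 0.
Proof.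
rewrite -unitmx_tr unitmxE unitfE negbK => /det0P[v v0 hv].
by exists v^T; rewrite ?trmx_eq0 //; apply: trmx_inj; rewrite trmx_mul trmxK hv trmx0.
Qed.

(** * Stable matrices are similar to strict contractions *)

(** Induction on the size: [T] is lower triangular, so the first coordinate evolves alone under [l]
    and enters the others only through the column [a]. *)
Lemma trig_contraction n (T : 'M[C]_n) : is_trig_mx T -> (forall i, `|T i i| < 1) ->
  exists (V : 'M[C]_n) (rho : C), [/\ V \in unitmx, 0 <= rho, rho < 1 &
    forall x : 'cV_n, vnorm2 (V *m T *m x) <= rho * vnorm2 (V *m x)].
Proof.
elim: n T => [|n IHn] T.
  move=> _ _; exists 1%:M, 0; split; rewrite ?unitmx1 ?ltr01 // => x.
  by rewrite /vnorm2 !big_ord0 mulr0.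
rewrite -[n.+1]/(1 + n)%N in T *; rewrite -(submxK T).
set l := ulsubmx T; set a := dlsubmx T; set T' := drsubmx T => Ttrig Tdiag.
move: Ttrig; rewrite is_trig_block_mx // => /and3P[/eqP u0 _ T'trig].
rewrite u0 in Tdiag *.
have l1 : `|l 0 0| < 1.
  by have := Tdiag (lshift n 0); rewrite block_mxEul.
have T'1 i : `|T' i i| < 1.
  by have := Tdiag (rshift 1 i); rewrite block_mxEdr.
have [V [rho [Vu rho0 rho1 hV]]] := IHn T' T'trig T'1.
set L := `|l 0 0| ^+ 2.
have L0 : 0 <= L by rewrite exprn_ge0.
have L1 : L < 1 by rewrite expr_lt1.
(* Both gaps [1 - rho] and [1 - L] are at least [d + d]: one [d] pays for the coupling through [a],
   the other survives in the final rate [1 - d]. *)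
pose d := (1 - rho) * (1 - L) / 2%:R.
have d0 : 0 < d by rewrite !mulr_gt0 ?invr_gt0 ?ltr0n ?subr_gt0.
have drho : d + d <= 1 - rho.
  have -> : d + d = (1 - rho) * (1 - L) by rewrite /d; field.
  by rewrite ler_piMr ?subr_ge0 ?(ltW rho1) // lerBlDr lerDl.
have dL : d + d <= 1 - L.
  have -> : d + d = (1 - rho) * (1 - L) by rewrite /d; field.
  by rewrite ler_piMl ?subr_ge0 ?(ltW L1) // lerBlDr lerDl.
pose k := (1 + d^-1) * vnorm2 (V *m a).
have k0 : 0 <= k by rewrite mulr_ge0 ?vnorm2_ge0 // addr_ge0 ?invr_ge0 ?ler01 ?(ltW d0).
(* [k] is the AM-GM cost of the column [a] per unit of squared first coordinate; this weight gives
   [k <= d * c <= d * c ^+ 2]. *)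
pose c := 1 + k / d.
have c1 : 1 <= c by rewrite lerDl divr_ge0 ?(ltW d0).
have c0 : 0 < c by apply: lt_le_trans c1.
have kc : k <= d * c ^+ 2.
  apply: (@le_trans _ _ (d * c)).
    have -> : d * c = d + k by rewrite /c; field; rewrite gt_eqF.
    by rewrite lerDr ltW.
  by rewrite ler_pM2l // ler_eXnr.
(* A large weight [c] on the first coordinate makes the off-diagonal column [a] harmless. *)
exists (block_mx c%:M 0 0 V), (1 - d); split.
- rewrite unitmxE det_ublock det_scalar1 unitrM -unitmxE Vu andbT.
  by rewrite unitfE gt_eqF.
- rewrite subr_ge0; apply: le_trans (_ : d + d <= _); first by rewrite lerDl ltW.
  by rewrite (le_trans drho) // lerBlDr lerDl.
- by rewrite ltrBlDr ltrDl.
move=> x; rewrite -(vsubmxK x) mulmx_block !mul0mx !mulmx0 !addr0 !add0r.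
set y := usubmx x; set z := dsubmx x.
rewrite !mul_block_col !mul0mx !addr0 !add0r !vnorm2_col_mx.
have scal (M : 'M[C]_1) : M *m y = M 0 0 *: y.
  by rewrite [M in LHS]mx11_scalar mul_scalar_mx.
have yE : y = y 0 0 *: 1%:M by rewrite [LHS]mx11_scalar scalemx1.
rewrite !mul_scalar_mx scal [(c *: l) 0 0]mxE !vnorm2Z normrM !exprMn -/L.
rewrite (ger0_norm (ltW c0)).
have hz := vnorm2D_le (V *m a *m y) (V *m T' *m z) d0.
have ay : vnorm2 (V *m a *m y) = vnorm2 (V *m a) * vnorm2 y.
  rewrite {1}yE -scalemxAr mulmx1 vnorm2Z mulrC; congr (_ * _).
  by rewrite /vnorm2 big_ord1.
rewrite ay mulrA -/k in hz.
rewrite mulrDr -mulrA; set Y := vnorm2 y in hz *; set Z := vnorm2 (V *m z).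
have Y0 : 0 <= Y by apply: vnorm2_ge0.
have Z0 : 0 <= Z by apply: vnorm2_ge0.
have {hz}hz := le_trans hz (lerD (lexx _) (ler_wpM2l _ (hV z))).
apply: le_trans (lerD (lexx _) (hz _)) _; first by rewrite addr_ge0 ?ler01 ?(ltW d0).
(* The terms in [Y] need [L + d <= 1 - d], those in [Z] need [(1 + d) * rho <= rho + d <= 1 - d]. *)
rewrite -/Z addrA; apply: lerD.
  rewrite [c ^+ 2 * (L * Y)]mulrA -mulrDl [(1 - d) * _]mulrA ler_wpM2r //.
  rewrite [c ^+ 2 * L]mulrC; apply: le_trans (lerD (lexx _) kc) _.
  rewrite -mulrDl ler_wpM2r ?exprn_ge0 ?(ltW c0) //.
  by rewrite lerBrDr -addrA -lerBrDl.
rewrite mulrA ler_wpM2r // mulrDl mul1r.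
apply: le_trans (_ : rho + d <= _); first by rewrite lerD2l ler_piMr ?ltW.
by rewrite lerBrDr -addrA -lerBrDl.
Qed.

(** Schur triangularization puts the eigenvalues of [J] on the diagonal of a triangular matrix; the
    change of basis [P] is then absorbed into [V]. *)
Lemma spectral_contraction n (J : 'M[C]_n) :
  (forall z, eigenvalue J z -> `|z| < 1) ->
  exists (V : 'M[C]_n) (rho : C), [/\ V \in unitmx, 0 <= rho, rho < 1 &
    forall x : 'cV_n, vnorm2 (V *m J *m x) <= rho * vnorm2 (V *m x)].
Proof.
case: n J => [|n] J Jst.
  exists 1%:M, 0; split; rewrite ?unitmx1 ?ltr01 // => x.
  by rewrite /vnorm2 !big_ord0 mulr0.
have [P /unitarymx_unit Pu] := Schur J (ltn0Sn n).
rewrite /similar_to/= conjumx //; set T := P *m J *m invmx P => Ttrig.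
have TJ : T *m P = P *m J by rewrite /T mulmxKV.
clearbody T.
have Tdiag i : `|T i i| < 1.
  have /eigenvalueP[v vT v0] : eigenvalue T (T i i).
    rewrite eigenvalue_root_char char_poly_trig // /root horner_prod.
    by rewrite (bigD1 i) //= !hornerE subrr mul0r.
  apply/Jst/eigenvalueP; exists (v *m P).
    by rewrite -mulmxA -TJ mulmxA vT scalemxAl.
  by apply: contraNneq v0 => vP; rewrite -(mulmxK Pu v) vP mul0mx.
have [V [rho [Vu rho0 rho1 hV]]] := trig_contraction Ttrig Tdiag.
exists (V *m P), rho; split; rewrite ?unitmx_mul ?Vu // => x.
by have := hV (P *m x); rewrite !mulmxA -[V *m T *m P]mulmxA TJ !mulmxA.
Qed.

(** Elimination of the first coordinate with pivot [q]: the factor is upper triangular, with first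
    row made of [sqrtC q] and [b] divided by [sqrtC q], above a factor of the Schur complement. *)
Lemma posdef_cholesky n (P : 'M[C]_n) : is_real_mx P -> P^T = P ->
  (forall x : 'cV_n, is_real_mx x -> x != 0 -> 0 < (x^T *m P *m x) 0 0) ->
  exists S : 'M[C]_n, [/\ is_real_mx S, S \in unitmx & S^T *m S = P].
Proof.
elim: n P => [|n IHn] P.
  move=> _ _ _; exists 1%:M; split; rewrite ?unitmx1 //; first exact: real_mx1.
  by rewrite !flatmx0.
rewrite -[n.+1]/(1 + n)%N in P *; rewrite -(submxK P).
set p := ulsubmx P; set b := ursubmx P; set c := dlsubmx P; set P' := drsubmx P.
move=> /real_block_mx[pr br _ P'r]; rewrite tr_block_mx => /eq_block_mx[_ _ <- P'sym] pos.
have [q pE] : exists q, p = q%:M by exists (p 0 0); rewrite [LHS]mx11_scalar.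
rewrite {}pE {p} in pr pos *.
have p0 : 0 < q.
  have := pos (col_mx 1%:M 0); rewrite tr_col_mx mul_row_block mul_row_col.
  rewrite trmx1 trmx0 !mul0mx !mulmx0 !addr0 mul1mx mulmx1 [_ 0 0]mxE eqxx; apply.
    by apply: real_col_mx; [apply: real_mx1 | apply: real_mx0].
  rewrite col_mx_eq0 negb_and; apply/orP; left.
  by apply/eqP => /matrixP/(_ 0 0)/eqP; rewrite !mxE eqxx oner_eq0.
have p00 : q != 0 by rewrite gt_eqF.
set a := sqrtC q.
have aa : a * a = q by rewrite -expr2 sqrtCK.
have a0 : a != 0 by rewrite sqrtC_eq0.
have ar : a \is Num.real by rewrite sqrtC_real ?ltW.
(* the Schur complement *)
pose Q := P' - q^-1 *: (b^T *m b).
have Qr : is_real_mx Q.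
  rewrite /Q -scaleNr; apply: real_addmx => //; apply: real_scalemx.
    by rewrite rpredN rpredV gtr0_real.
  by apply: real_mulmx => //; apply: real_trmx.
have [] := IHn Q Qr.
- by rewrite /Q linearB linearZ /= trmx_mul trmxK P'sym.
(* The first coordinate is chosen to cancel [b *m y] in the first row, so the form of [P] at this
   vector equals the form of [Q] at [y], and positivity passes to [Q]. *)
- move=> y yr y0; have := pos (col_mx (- q^-1 *: (b *m y)) y).
  have -> : ((col_mx (- q^-1 *: (b *m y)) y)^T *m block_mx q%:M b b^T P' *m
    col_mx (- q^-1 *: (b *m y)) y) = y^T *m Q *m y.
    have -> : (col_mx (- q^-1 *: (b *m y)) y)^T =
        row_mx (- q^-1 *: (y^T *m b^T)) y^T.
      by rewrite tr_col_mx linearZ /= trmx_mul.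
    rewrite mul_row_block mul_row_col mul_mx_scalar scalerA mulrN mulfV //.
    rewrite scaleN1r addNr mul0mx add0r /Q mulmxBr mulmxBl mulmxDl addrC.
    by rewrite -!scalemxAl -!scalemxAr -!scalemxAl scaleNr !mulmxA.
  apply; last by rewrite col_mx_eq0 negb_and y0 orbT.
  apply: real_col_mx => //; apply: real_scalemx; last exact: real_mulmx.
  by rewrite rpredN rpredV gtr0_real.
move=> S [Sr Su SS]; exists (block_mx a%:M (a^-1 *: b) 0 S); split.
- apply/real_block_mx; split => //; [exact: real_scalar_mx| |exact: real_mx0].
  by apply: real_scalemx => //; rewrite rpredV.
- by rewrite unitmxE det_ublock det_scalar1 unitrM -unitmxE Su unitfE a0.
rewrite tr_block_mx mulmx_block tr_scalar_mx trmx0 !mul0mx !mulmx0 !addr0.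
have -> : (a^-1 *: b)^T = a^-1 *: b^T by rewrite linearZ.
rewrite -scalar_mxM aa mul_scalar_mx mul_mx_scalar !scalerA mulfV // !scale1r.
rewrite SS /Q -scalemxAl -scalemxAr scalerA -invfM aa.
by rewrite addrC subrK.
Qed.

(** Multiplication by a real vector commutes with taking real parts, and the squared norm of
    [V *m x] is already real. *)
Lemma mxRe_gram n (V : 'M[C]_n) (x : 'cV_n) : is_real_mx x ->
  (x^T *m mxRe ((map_mx Num.conj V)^T *m V) *m x) 0 0 = vnorm2 (V *m x).
Proof.
move=> xr; set G := _^T *m V.
have ReT m k (M : 'M[C]_(m, k)) : (mxRe M)^T = mxRe M^T by apply/matrixP => i j; rewrite !mxE.
rewrite -mxRe_mulmx; last exact: real_trmx.
have -> : mxRe (x^T *m G) *m x = mxRe (x^T *m G *m x).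
  apply: trmx_inj; rewrite trmx_mul !ReT (trmx_mul _ x) mxRe_mulmx //.
  exact: real_trmx.
rewrite mxE /G.
have -> : (x^T *m ((map_mx Num.conj V)^T *m V) *m x) 0 0 = vnorm2 (V *m x).
  by rewrite vnorm2_dot map_mxM ((is_real_mxP x).1 xr) // trmx_mul !mulmxA.
by apply/Creal_ReP; rewrite ger0_real ?vnorm2_ge0.
Qed.

Lemma real_contraction n (J : 'M[C]_n) : is_real_mx J ->
  (forall z, eigenvalue J z -> `|z| < 1) ->
  exists (S : 'M[C]_n) (rho : C), [/\ is_real_mx S, S \in unitmx, rho < 1 &
    forall x : 'cV_n, is_real_mx x ->
      vnorm2 (S *m J *m invmx S *m x) <= rho * vnorm2 x].
Proof.
(* [J] is real, so a complex contraction norm [|V x|] for [J] restricts to a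
   real Euclidean norm, with Gram matrix the real part of [V^* V]. *)
move=> Jr /spectral_contraction[V [rho [Vu _ rho1 hV]]].
set P := mxRe ((map_mx Num.conj V)^T *m V).
have [||x xr x0|S [Sr Su SS]] := @posdef_cholesky _ P.
- exact: real_mxRe.
(* The Gram matrix is Hermitian, hence its real part is symmetric. *)
- apply/matrixP => i j; rewrite !mxE -Re_conj rmorph_sum; congr (Re _).
  apply: eq_bigr => k _. by rewrite !mxE rmorphM /= conjCK mulrC.
- rewrite mxRe_gram // vnorm2_gt0; apply: contraNneq x0 => Vx0.
  by rewrite -(mulKmx Vu x) Vx0 mulmx0.
have SV x : is_real_mx x -> vnorm2 (S *m x) = vnorm2 (V *m x).
  move=> xr; rewrite -(mxRe_gram V xr) -/P -SS vnorm2_real; last exact: real_mulmx.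
  by rewrite trmx_mul !mulmxA.
exists S, rho; split => // x xr.
have Sxr : is_real_mx (invmx S *m x) by apply: real_mulmx => //; apply: real_invmx.
rewrite -!mulmxA SV; last exact: real_mulmx.
rewrite -{2}(mulKVmx Su x) SV //.
by rewrite mulmxA; apply: hV.
Qed.

(** * Real singular value and polar decompositions *)

Lemma dot_unit n (u : 'cV[C]_n) : is_real_mx u -> vnorm2 u = 1 -> u^T *m u = 1%:M.
Proof. by move=> ur u1; rewrite [LHS]mx11_scalar -vnorm2_real // u1. Qed.

(** Since [M] and [a] are real, the real and imaginary parts of [x] both satisfy the eigenvector
    equation; one of them is nonzero and can be normalized. *)
Lemma real_unit_eigenvector n (M : 'M[C]_n) (a : C) (x : 'cV_n) :
  is_real_mx M -> a \is Num.real -> M *m x = a *: x -> x != 0 ->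
  exists u : 'cV_n, [/\ is_real_mx u, vnorm2 u = 1 & M *m u = a *: u].
Proof.
move=> Mr ar Mx x0.
suff [y [yr y0 My]] : exists y : 'cV_n, [/\ is_real_mx y, y != 0 & M *m y = a *: y].
  have ny : 0 < vnorm2 y by rewrite vnorm2_gt0.
  have sr : (sqrtC (vnorm2 y))^-1 \is Num.real by rewrite rpredV sqrtC_real ?ltW.
  exists ((sqrtC (vnorm2 y))^-1 *: y); split; first exact: real_scalemx.
    rewrite vnorm2Z normfV ger0_norm ?sqrtC_ge0 ?ltW // exprVn sqrtCK.
    by rewrite mulVf // gt_eqF.
  by rewrite -scalemxAr My !scalerA mulrC.
have ReM : M *m mxRe x = a *: mxRe x.
  rewrite -mxRe_mulmx // Mx; apply/matrixP => i j; rewrite !mxE; exact: ReMl.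
have ImM : M *m mxIm x = a *: mxIm x.
  rewrite -mxIm_mulmx // Mx; apply/matrixP => i j; rewrite !mxE; exact: ImMl.
have [Re0|Re0] := eqVneq (mxRe x) 0; last by exists (mxRe x); split => //; exact: real_mxRe.
exists (mxIm x); split => //; first exact: real_mxIm.
by apply: contraNneq x0 => Im0; rewrite (mxRect x) Re0 Im0 scaler0 addr0.
Qed.

(** The reflection in the hyperplane orthogonal to [e - u] exchanges the unit vectors [e] and [u];
    if they coincide, the identity serves. *)
Lemma householder n (u : 'cV[C]_(1 + n)) : is_real_mx u -> vnorm2 u = 1 ->
  exists H : 'M_(1 + n),
    [/\ is_real_mx H, H^T *m H = 1%:M & H *m col_mx 1%:M 0 = u].
Proof.
move=> ur u1; set e : 'cV_(1 + n) := col_mx 1%:M 0.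
have er : is_real_mx e by apply: real_col_mx; [exact: real_mx1 | exact: real_mx0].
have ee : e^T *m e = 1%:M.
  by rewrite tr_col_mx mul_row_col trmx1 trmx0 mul1mx mul0mx addr0.
have uu := dot_unit ur u1.
have [ue|ue] := eqVneq e u.
  by exists 1%:M; rewrite trmx1 !mul1mx; split => //; exact: real_mx1.
pose w := e - u.
have wr : is_real_mx w.
  by rewrite /w -scaleN1r; apply: real_addmx => //; apply: real_scalemx; rewrite ?realN ?real1.
pose q := vnorm2 w.
have q0 : q != 0 by rewrite vnorm2_eq0 subr_eq0.
have ww : w^T *m w = q%:M by rewrite [LHS]mx11_scalar -vnorm2_real.
have eu : e^T *m u = u^T *m e.
  rewrite -[RHS]trmxK trmx_mul trmxK.
  by apply/matrixP => i j; rewrite [RHS]mxE !ord1.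
(* As [e] and [u] have the same length, [w] has squared length twice its product with [e]; hence the
   reflection subtracts exactly [w] from [e]. *)
have we : w^T *m e = (q / 2%:R)%:M.
  have -> : w^T *m e = 2%:R^-1 *: (w^T *m w).
    rewrite /w [(e - u)^T]linearB /= !mulmxBr !mulmxBl ee uu eu.
    by apply/matrixP => i j; rewrite !mxE; field.
  by rewrite ww scale_scalar_mx mulrC.
pose H := 1%:M - (2%:R / q) *: (w *m w^T).
have HT : H^T = H by rewrite /H linearB linearZ /= trmx1 trmx_mul trmxK.
exists H; split.
- rewrite /H -scaleNr; apply: real_addmx; first exact: real_mx1.
  apply: real_scalemx; last by apply: real_mulmx => //; exact: real_trmx.
  by rewrite rpredN rpred_div ?realn // ger0_real ?vnorm2_ge0.
- rewrite HT /H mulmxBl mul1mx mulmxBr mulmx1 -scalemxAl -scalemxAr -mulmxA.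
  rewrite [w^T *m _]mulmxA ww mul_scalar_mx -scalemxAr.
  by apply/matrixP => i j; rewrite !mxE; field.
rewrite /H mulmxBl mul1mx -scalemxAl -mulmxA we mul_mx_scalar scalerA.
have -> : 2%:R / q * (q / 2%:R) = 1 by field.
by rewrite scale1r /w opprB addrC subrK.
Qed.

(** For invertible [K], an eigenvalue [a] of [K^T *m K] is positive, and [s] is its square root with
    [u] equal to [K *m v] divided by [s]. For singular [K] that quotient may fail, so [s = 0] is
    taken with [v] and [u] from the kernels of [K] and [K^T]. *)
Lemma singular_pair n (K : 'M[C]_n.+1) : is_real_mx K ->
  exists (u v : 'cV_n.+1) (s : C),
    [/\ is_real_mx u, is_real_mx v, vnorm2 u = 1 & vnorm2 v = 1] /\
    [/\ 0 <= s, K *m v = s *: u & K^T *m u = s *: v].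
Proof.
move=> Kr; have KTr := real_trmx Kr.
have [Ku|Ks] := boolP (K \in unitmx); last first.
  have [x x0 Kx] := singular_ker Ks.
  have [y y0 Ky] : exists2 y : 'cV_n.+1, y != 0 & K^T *m y = 0.
    by apply: singular_ker; rewrite unitmx_tr.
  have [|v [vr v1 Kv]] := @real_unit_eigenvector _ K 0 x Kr (real0 _) _ x0.
    by rewrite scale0r.
  have [|u [ur uv1 Ku]] := @real_unit_eigenvector _ K^T 0 y KTr (real0 _) _ y0.
    by rewrite scale0r.
  by exists u, v, 0; split => //; split=> //; rewrite ?Kv ?Ku !scale0r.
have [a /eigenvalueP[y ya y0]] := eigenvalue_closed (K^T *m K) (ltn0Sn n).
set x := y^T; have x0 : x != 0 by rewrite trmx_eq0.
have Kx : K^T *m K *m x = a *: x.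
  apply: trmx_inj; rewrite /x [RHS]linearZ /= trmxK -ya.
  by rewrite trmx_mul trmxK; congr (_ *m _); rewrite trmx_mul trmxK.
have nK z : K^T *m K *m z = a *: z -> vnorm2 (K *m z) = a * vnorm2 z.
  move=> Kz; rewrite !vnorm2_dot map_mxM ((is_real_mxP K).1 Kr) trmx_mul.
  rewrite mulmxA -[_ *m K^T *m K]mulmxA -mulmxA Kz -scalemxAr.
  by rewrite mxE.
have Kinj z : z != 0 -> K *m z != 0.
  by apply: contraNneq => Kz; rewrite -(mulKmx Ku z) Kz mulmx0.
have a0 : 0 < a.
  have : 0 < a * vnorm2 x by rewrite -nK // vnorm2_gt0 Kinj.
  by rewrite pmulr_lgt0 ?vnorm2_gt0.
have KKr : is_real_mx (K^T *m K) by apply: real_mulmx.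
have [v [vr v1 Kv]] := real_unit_eigenvector KKr (gtr0_real a0) Kx x0.
have s0 : 0 < sqrtC a by rewrite sqrtC_gt0.
exists ((sqrtC a)^-1 *: (K *m v)), v, (sqrtC a); split; split => //.
- by apply: real_scalemx; [rewrite rpredV gtr0_real | exact: real_mulmx].
- rewrite vnorm2Z nK // v1 mulr1 normfV gtr0_norm // exprVn sqrtCK.
  by rewrite mulVf // gt_eqF.
- exact: ltW.
- by rewrite scalerA mulfV ?scale1r // gt_eqF.
rewrite -scalemxAr mulmxA Kv scalerA; congr (_ *: _).
by rewrite -{2}(sqrtCK a) expr2 mulKf // gt_eqF.
Qed.

(** Deflation: reflections sending the first basis vector to [u] and to [v] turn [K] into a block
    diagonal matrix with corner [s], and induction treats the other block. *)
Lemma real_svd n (K : 'M[C]_n) : is_real_mx K ->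
  exists (P Q : 'M_n) (d : 'rV_n),
    [/\ is_real_mx P, is_real_mx Q, P^T *m P = 1%:M & Q^T *m Q = 1%:M] /\
    (forall i, 0 <= d 0 i) /\ K = P *m diag_mx d *m Q^T.
Proof.
elim: n K => [|n IHn] K Kr.
  exists 1%:M, 1%:M, 0; split; last by split=> [i|]; [rewrite mxE | rewrite flatmx0 [RHS]flatmx0].
  by rewrite trmx1 mulmx1; split => //; exact: real_mx1.
have [u [v [s [[ur vr u1 v1] [s0 Kv Ku]]]]] := singular_pair Kr.
rewrite -[n.+1]/(1 + n)%N in K Kr u v ur vr u1 v1 Kv Ku *.
have [G [Gr GG Ge]] := householder ur u1.
have [H [Hr HH He]] := householder vr v1.
set e := col_mx _ _ in Ge He.
pose M := G^T *m K *m H.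
have Me : M *m e = s *: e.
  by rewrite -mulmxA He -mulmxA Kv -scalemxAr -Ge mulmxA GG mul1mx.
have MTe : M^T *m e = s *: e.
  rewrite /M !trmx_mul trmxK -!mulmxA Ge Ku -scalemxAr -He.
  by rewrite mulmxA HH mul1mx.
have KM : K = G *m M *m H^T.
  have GG' := mulmx1C GG; have HH' := mulmx1C HH.
  by rewrite /M !mulmxA GG' mul1mx -mulmxA HH' mulmx1.
have Mr : is_real_mx M by apply: real_mulmx => //; apply: real_mulmx => //; exact: real_trmx.
clearbody M; rewrite -(submxK M) in Me MTe KM Mr.
move: (ulsubmx M) (ursubmx M) (dlsubmx M) (drsubmx M) Me MTe KM Mr => m1 m2 m3 K'.
rewrite tr_block_mx /e scale_col_mx scaler0 !mul_block_col !mulmx0 !addr0 !mulmx1.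
(* The equation for [M] determines its first column, the one for [M^T] clears the rest of its first
   row. *)
move=> /eq_col_mx[-> ->] /eq_col_mx[_ /(congr1 trmx)]; rewrite trmxK trmx0 => ->.
move=> KM /real_block_mx[_ _ _ K'r].
have [P [Q [d [[Pr Qr PP QQ] [d0 K'E]]]]] := IHn K' K'r.
exists (G *m block_mx 1%:M 0 0 P), (H *m block_mx 1%:M 0 0 Q), (row_mx s%:M d).
split; [split|split].
- by apply: real_mulmx => //; apply/real_block_mx; split => //; by [exact: real_mx1|exact: real_mx0].
- by apply: real_mulmx => //; apply/real_block_mx; split => //; by [exact: real_mx1|exact: real_mx0].
- rewrite trmx_mul mulmxA -[_ *m G^T *m G]mulmxA GG mulmx1 tr_block_mx mulmx_block.
  by rewrite trmx1 !trmx0 !mul0mx !mulmx0 mulmx1 !addr0 !add0r PP -scalar_mx_block.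
- rewrite trmx_mul mulmxA -[_ *m H^T *m H]mulmxA HH mulmx1 tr_block_mx mulmx_block.
  by rewrite trmx1 !trmx0 !mul0mx !mulmx0 mulmx1 !addr0 !add0r QQ -scalar_mx_block.
- move=> i; rewrite mxE; case: splitP => k _ //; rewrite mxE ord1 eqxx //.
rewrite KM K'E trmx_mul tr_block_mx trmx1 !trmx0 diag_mx_row.
have -> : diag_mx s%:M = s%:M :> 'M_1.
  by apply/matrixP => i j; rewrite !mxE !ord1 eqxx.
rewrite !mulmxA; congr (_ *m _); rewrite -!mulmxA; congr (_ *m _).
rewrite !mulmx_block !(mul0mx, mulmx0, addr0, add0r, mul1mx, mulmx1).
by rewrite scalemx1 mulmxA.
Qed.

Lemma vnorm2_diag_mx n (d : 'rV[C]_n) (y : 'cV_n) :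
  vnorm2 (diag_mx d *m y) = \sum_i `|d 0 i| ^+ 2 * `|y i 0| ^+ 2.
Proof. by apply: eq_bigr => i _; rewrite mul_diag_mx mxE normrM exprMn. Qed.

Lemma vnorm2_delta_mx n (i : 'I_n) : vnorm2 (delta_mx i 0 : 'cV[C]_n) = 1.
Proof.
rewrite /vnorm2 (bigD1 i) //= mxE !eqxx normr1 expr1n big1 ?addr0 // => j ji.
by rewrite mxE (negPf ji) normr0 expr0n.
Qed.

Lemma vnorm2_diag_delta n (d : 'rV[C]_n) (i : 'I_n) : 
  vnorm2 (diag_mx d *m delta_mx i 0) = `|d 0 i| ^+ 2.
Proof.
have -> : diag_mx d *m delta_mx i 0 = d 0 i *: (delta_mx i 0 : 'cV_n).
  apply/colP => j; rewrite mul_diag_mx !mxE.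
  by case: (eqVneq j i) => [->//|_]; rewrite !mulr0.
by rewrite vnorm2Z vnorm2_delta_mx mulr1.
Qed.

(** Orthogonal factors preserve lengths, so the norm is that of the diagonal matrix: its largest
    entry [d 0 i], attained at column [i] of [Q]. *)
Lemma psd_spec_norm n (Q : 'M[C]_n) (d : 'rV_n) : is_real_mx Q -> Q^T *m Q = 1%:M ->
  (forall i, 0 <= d 0 i) -> (forall i, d 0 i < 1) ->
  exists s, is_spec_norm (Q *m diag_mx d *m Q^T) s /\ s < 1.
Proof.
move=> Qr QQ d0 d1; have QTr := real_trmx Qr.
have normB x : vnorm2 (Q *m diag_mx d *m Q^T *m x) = vnorm2 (diag_mx d *m (Q^T *m x)).
  by rewrite -!mulmxA vnorm2_orth.
have normQT (x : 'cV_n) : vnorm2 (Q^T *m x) = vnorm2 x.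
  by rewrite vnorm2_orth // trmxK (mulmx1C QQ).
(* An empty matrix has no largest diagonal entry; its norm is 0. *)
case: n Q d Qr QTr QQ d0 d1 normB normQT => [|n] Q d Qr QTr QQ d0 d1 normB normQT.
  exists 0; split; last exact: ltr01.
  by split=> // x _; rewrite /vnorm2 !big_ord0 mulr0.
have [i _ imax] := @real_arg_maxP _ _ ord0 xpredT (fun i => d 0 i) isT
  (fun i _ => ger0_real (d0 i)).
exists (d 0 i); split; last exact: d1.
split; [exact/ger0_real/d0 | exact: d0 | |].
- move=> x _; rewrite normB -(normQT x) vnorm2_diag_mx /vnorm2 mulr_sumr.
  apply: ler_sum => j _; rewrite ler_wpM2r ?exprn_ge0 // ger0_norm //.
  by rewrite lerXn2r ?nnegrE //; exact: imax.
move=> c cr c0 /(_ (Q *m delta_mx i 0)).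
rewrite normB mulmxA QQ mul1mx vnorm2_diag_delta vnorm2_orth // vnorm2_delta_mx.
rewrite mulr1 ger0_norm // ler_pXn2r ?nnegrE //; apply.
by apply: real_mulmx => //; exact: real_delta_mx.
Qed.

(** Inserting [Q^T *m Q] into the singular value decomposition regroups it as
    [(P *m Q^T) *m (Q *m diag_mx d *m Q^T)]. *)
Lemma contraction_polar n (K : 'M[C]_n) (rho : C) : is_real_mx K -> rho < 1 ->
  (forall x : 'cV_n, is_real_mx x -> vnorm2 (K *m x) <= rho * vnorm2 x) ->
  exists U B : 'M_n,
    [/\ is_real_mx U, is_real_mx B, U^T *m U = 1%:M, sym_psd B & K = U *m B] /\
    exists s, is_spec_norm B s /\ s < 1.
Proof.
move=> Kr rho1 hK.
have [P [Q [d [[Pr Qr PP QQ] [d0 KE]]]]] := real_svd Kr.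
have QTr := real_trmx Qr.
have dr : is_real_mx (diag_mx d).
  by apply: real_diag_mx; apply/mxOverP => i j; rewrite ord1 ger0_real.
(* Column [i] of [Q] is a unit vector that [K] stretches by [d 0 i], so the square of this entry is
   at most [rho]. *)
have d1 i : d 0 i < 1.
  have := hK (Q *m delta_mx i 0) (real_mulmx Qr (real_delta_mx _ _)).
  rewrite KE -!mulmxA vnorm2_orth // [Q^T *m _]mulmxA QQ mul1mx vnorm2_diag_delta.
  rewrite vnorm2_orth // vnorm2_delta_mx mulr1 ger0_norm // => /le_lt_trans/(_ rho1).
  by rewrite expr_lt1.
exists (P *m Q^T), (Q *m diag_mx d *m Q^T); split; last exact: psd_spec_norm.
split.
- exact: real_mulmx.
- by apply: real_mulmx => //; exact: real_mulmx.
- by rewrite trmx_mul trmxK mulmxA -[_ *m P^T *m P]mulmxA PP mulmx1 (mulmx1C QQ).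
- split; first by rewrite !trmx_mul trmxK tr_diag_mx mulmxA.
  move=> x xr; set y := Q^T *m x.
  have -> : x^T *m (Q *m diag_mx d *m Q^T) *m x = y^T *m (diag_mx d *m y).
    by rewrite /y trmx_mul trmxK !mulmxA.
  have /mxOverP yr : is_real_mx y by apply: real_mulmx.
  rewrite mxE sumr_ge0 // => i _; rewrite mul_diag_mx [y^T _ _]mxE [X in _ * X]mxE mulrCA mulr_ge0 //.
  by rewrite -expr2 real_exprn_even_ge0.
by rewrite KE !mulmxA -[_ *m Q^T *m Q]mulmxA QQ mulmx1.
Qed.

(** * Pencils in index-one form *)

(** Once [W] and [T] are factored out, the pencil is block diagonal with blocks [z%:M - K] and
    [- 1%:M], the latter of determinant a sign. Finite eigenvalues of the pair are thus those of
    [K]. *)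
Lemma det_weierstrass r m (W T : 'M[C]_(r + m)) (K : 'M_r) (z : C) :
  W \in unitmx -> T \in unitmx ->
  (\det (z *: (W *m block_mx 1%:M 0 0 0 *m T) - W *m block_mx K 0 0 1%:M *m T) == 0)
  = (\det (z%:M - K) == 0).
Proof.
move=> Wu Tu; rewrite scalemxAl scalemxAr -mulmxBl -mulmxBr.
rewrite scale_block_mx !scaler0 opp_block_mx add_block_mx !oppr0 !addr0 add0r scalemx1.
rewrite !det_mulmx det_ublock -[- 1%:M]scaleN1r detZ det1 mulr1 !mulf_eq0 signr_eq0 orbF.
by move: Wu Tu; rewrite !unitmxE !unitfE => /negPf-> /negPf->; rewrite orbF.
Qed.

(* Stability forces [det (zE - A)] to be nonzero at [z = 1]. *)
Lemma stable_regular n (E A : 'M[C]_n) : asympt_stable E A -> regular_pair E A.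
Proof.
move=> st; apply/eqP => det0; suff /st : finite_eigenvalue E A 1 by rewrite normr1 ltxx.
rewrite /finite_eigenvalue scale1r.
have <- : \det (map_mx (horner_eval (1 : C)) (pencil E A)) = 0.
  by rewrite det_map_mx det0 rmorph0.
congr (\det _).
by apply/matrixP => i j; rewrite !mxE /horner_eval !hornerE.
Qed.

Lemma spec_norm_stable r m (T W : 'M[C]_(r + m)) (S U B : 'M_r) (s : C) :
  T \in unitmx -> W \in unitmx -> S \in unitmx ->
  is_real_mx U -> U^T *m U = 1%:M -> is_real_mx B -> is_spec_norm B s -> s < 1 ->
  asympt_stable (W *m block_mx 1%:M 0 0 0 *m T)
    (W *m block_mx (invmx S *m U *m B *m S) 0 0 1%:M *m T).
Proof.
move=> Tu Wu Su Ur UU Br [_ s0 hB _] s1 z /eqP; rewrite det_weierstrass //.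
rewrite -[_ == 0]negbK -unitfE -unitmxE => /singular_ker[x x0].
rewrite mulmxBl mul_scalar_mx => /subr0_eq zx.
have Sx0 : S *m x != 0.
  by apply: contraNneq x0 => Sx; rewrite -(mulKmx Su x) Sx mulmx0.
(* In the coordinates [S *m x], possibly complex, [U *m B] multiplies the kernel vector by [z]. *)
have : vnorm2 (U *m (B *m (S *m x))) = `|z| ^+ 2 * vnorm2 (S *m x).
  by rewrite -vnorm2Z scalemxAr zx -!mulmxA mulKVmx.
rewrite vnorm2_orth // => Bz; have := real_bound_complex Br hB (S *m x).
rewrite Bz ler_pM2r ?vnorm2_gt0 // ler_pXn2r ?nnegrE // => /le_lt_trans; exact.
Qed.

Lemma index_le1_form r m (E A : 'M[C]_(r + m)) : \rank E = r -> index_le1 E A ->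
  exists (W T : 'M_(r + m)) (J : 'M_r),
    [/\ is_real_mx W, is_real_mx T, is_real_mx J, W \in unitmx & T \in unitmx] /\
    E = W *m block_mx 1%:M 0 0 0 *m T /\ A = W *m block_mx J 0 0 1%:M *m T.
Proof.
move=> rE [k [k1 [q [m' [h [W [T [J [N [[Wr Tr Jr Nr]]]]]]]]]]].
move=> [[Wu Tu _] [EE [AE hk]]].
have N0 : N = 0.
  (* If [q < n], then [N] itself vanishes or [N ^+ 0], the identity, does; if [q = n], then [N] is
     empty. *)
  case: ltnP hk => [_ [Nk Nlt]|qn _]; last first.
    suff m'0 : m' = 0 by move: N {Nr EE}; rewrite m'0 => N; rewrite [N]flatmx0.
    by apply/eqP; move: qn; rewrite -h -[X in (_ <= X)%N]addn0 leq_add2l leqn0.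
  case: k k1 Nk {Nlt} => [|[|//]] _; last by rewrite expr1.
  by rewrite expr0 => N1; rewrite -[N]mulmx1 (_ : 1%:M = 0) ?mulmx0.
(* With [N = 0], the rank of [E] is the size of the identity block. *)
have qr : q = r.
  rewrite -rE EE mxrankMfree ?row_free_unit // eqmxMfull ?row_full_unit //.
  have castrank p (e : (q + m' = p)%N) (M : 'M[C]_(q + m')) :
    \rank (castmx (e, e) M) = \rank M by case: _ / e.
  by rewrite castrank rank_diag_block_mx mxrank1 N0 mxrank0 addn0.
subst q; have mE : m' = m by apply/eqP; rewrite -(eqn_add2l r) h.
subst m'; exists W, T, J; split => //.
by move: EE AE; rewrite (eq_irrelevance h erefl) !castmx_id N0.
Qed.

Lemma form_index_le1 r m (W T : 'M[C]_(r + m)) (J : 'M_r) :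
  is_real_mx W -> is_real_mx T -> is_real_mx J -> W \in unitmx -> T \in unitmx ->
  index_le1 (W *m block_mx 1%:M 0 0 0 *m T) (W *m block_mx J 0 0 1%:M *m T).
Proof.
(* The boolean read as a number is the index: 0 if there is no nilpotent block, and otherwise 1,
   since a nonempty zero matrix has a nonzero power [N ^+ 0]. *)
move=> Wr Tr Jr Wu Tu; exists (0 < m)%N; split; first exact: leq_b1.
exists r, m, erefl, W, T, J, 0; rewrite !castmx_id; split.
  by split => //; exact: real_mx0.
split; first by split => //; exists 1; rewrite expr1.
do 2!split => //; rewrite -[X in (X < _)%N]addn0 ltn_add2l.
case: m {W T Wr Tr Wu Tu} => [//|m] /=; split; first by rewrite expr1.
by case=> // _; rewrite expr0; exact: (oner_neq0 'M[C]_m.+1).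
Qed.

End RealContractions.

(* n = r + m, so rank E = r <= n is built in *)
Theorem theorem5 (C : numClosedFieldType) (r m : nat) (E A : 'M[C]_(r + m)) :
  is_real_mx E -> is_real_mx A -> \rank E = r ->
  (regular_pair E A /\ index_le1 E A /\ asympt_stable E A) <->
  (exists (T W : 'M[C]_(r + m)) (S U B : 'M[C]_r),
     [/\ is_real_mx T, is_real_mx W, is_real_mx S, is_real_mx U & is_real_mx B] /\
     [/\ T \in unitmx, W \in unitmx, S \in unitmx, U^T *m U = 1%:M & sym_psd B] /\
     (exists s, is_spec_norm B s /\ s < 1) /\
     E = W *m block_mx 1%:M 0 0 0 *m T /\
     A = W *m block_mx (invmx S *m U *m B *m S) 0 0 1%:M *m T).
Proof.
move=> _ _ rE; split; last first.
  move=> [T [W [S [U [B [[Tr Wr Sr Ur Br] [[Tu Wu Su UU _] [[s [hs s1]] [-> ->]]]]]]]]].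
  have st := spec_norm_stable Tu Wu Su Ur UU Br hs s1.
  split; [exact: stable_regular | split=> //].
  apply: form_index_le1 => //.
  by apply: real_mulmx => //; do 2!apply: real_mulmx => //; exact: real_invmx.
move=> [_ [/(index_le1_form rE)[W [T [J [[Wr Tr Jr Wu Tu] [-> ->]]]]] st]].
have Jst z : eigenvalue J z -> `|z| < 1.
  move=> Jz; apply: st; apply/eqP; rewrite det_weierstrass //.
  have [v vJ v0] := eigenvalueP Jz; apply/det0P; exists v => //.
  by rewrite mulmxBr mul_mx_scalar vJ subrr.
have [S [rho [Sr Su rho1 hS]]] := real_contraction Jr Jst.
have Kr : is_real_mx (S *m J *m invmx S).
  by apply: real_mulmx; [exact: real_mulmx | exact: real_invmx].
(* The polar form is taken of [S *m J *m invmx S]; conjugating back recovers [J]. *)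
have [U [B [[Ur Br UU Bpsd KE] hB]]] := contraction_polar Kr rho1 hS.
exists T, W, S, U, B; do 3!split => //; split => //.
by rewrite -[_ *m U *m B]mulmxA -KE !mulmxA mulVmx // mul1mx mulmxKV.
Qed.
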